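(* For every nondefective (i.e. diagonalizable) matrix $A\in\mathbb{C}^{n\times n}$ with diagonalization $A=V\Lambda V^{-1}$, $$G(A)=F_{H}(A)\qquad\text{with } H=(VV^{*})^{-1},$$ where $G(A)$ is the generalized two-sided field of values of $A$ (formed with this $V$) and $F_H(A)$ is Givens' field of values of $A$ associated with the Hermitian positive definite matrix $H$.
   Context: $X^{*}$ denotes the conjugate transpose. For a Hermitian positive definite matrix $H\in\mathbb{C}^{n\times n}$, Givens' field of values is $F_{H}(A)=\{x^{*}HAx : x\in\mathbb{C}^{n},\ x^{*}Hx=1\}$. For a nondefective matrix $A\in\mathbb{C}^{n\times n}$ with diagonalization $A=V\Lambda V^{-1}$ ($V$ nonsingular with columns right eigenvectors of $A$, $\Lambda$ the diagonal matrix of eigenvalues), the generalized two-sided field of values is $$G(A)=\{y^{*}Ax : x,y\in\mathbb{C}^{n},\ y=(VV^{*})^{-1}x,\ y^{*}x=1\}.$$ *)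

(* Defs.v *)
From HB Require Import structures.
From mathcomp Require Import all_boot all_order all_algebra.
From mathcomp Require Import sesquilinear spectral complex.
From mathcomp Require Import boolp classical_sets reals.

Set Implicit Arguments.
Unset Strict Implicit.
Unset Printing Implicit Defensive.

Import Order.TTheory GRing.Theory Num.Theory.
Local Open Scope ring_scope.
Local Open Scope classical_set_scope.
Local Open Scope sesquilinear_scope.

(* Vectors are columns, and [M ^t*] is the conjugate transpose; a scalar such
   as [y^* A x] is the unique entry of a 1 x 1 matrix. The complex numbers
   are [R[i]] with [R : realType]. *)

Section FieldsOfValues.
Variables (R : realType) (n : nat).
Local Notation C := R[i].

(* The order of [R[i]] is partial: [0 < z] means that z is real and positive. *)
Definition hermitian_posdef (H : 'M[C]_n) : Prop :=
  H \is hermsymmx /\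
  forall x : 'cV[C]_n, x != 0 -> 0 < (x ^t* *m H *m x) 0 0.

(* The diagonal entry [lambda 0 j] is the eigenvalue of A for the right
   eigenvector [col j V]. *)
Definition diagonalization (A V : 'M[C]_n) (lambda : 'rV[C]_n) : Prop :=
  V \in unitmx /\ A = V *m diag_mx lambda *m invmx V.

(* Meant for Hermitian positive definite H. *)
Definition givens_fov (H A : 'M[C]_n) : set C :=
  [set z | exists2 x : 'cV[C]_n,
     (x ^t* *m H *m x) 0 0 = 1 & z = (x ^t* *m H *m A *m x) 0 0].

(* Meant for V diagonalizing A; the set is relative to this V. *)
Definition gen_two_sided_fov (A V : 'M[C]_n) : set C :=
  [set z | exists x y : 'cV[C]_n,
     [/\ y = invmx (V *m V ^t*) *m x,
         (y ^t* *m x) 0 0 = 1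
       & z = (y ^t* *m A *m x) 0 0]].

End FieldsOfValues.

(* Main.v *)
Require Import Defs.
From HB Require Import structures.
From mathcomp Require Import all_boot all_order all_algebra.
From mathcomp Require Import sesquilinear spectral complex.
From mathcomp Require Import boolp classical_sets reals.

Import GRing.Theory.
Local Open Scope ring_scope.
Local Open Scope classical_set_scope.
Local Open Scope sesquilinear_scope.

(** Let [H] be the inverse of [V V^*].  With [W = V^-1] one has [H = W^* W]
    ([invmx_gram]), so [H] is Hermitian and [x^* H x] is the squared Euclidean
    norm of [W x], positive for [x != 0] because [W] is injective
    ([posdef_gram]).  The two fields of values are then parametrized by the same
    [x]: the vector [y] attached to [x] by the two-sided field of values is
    [H x], and since [H] is Hermitian [y^* = x^* H], which turns [y^* x] into
    [x^* H x] and [y^* A x] into [x^* H A x] ([gen_two_sided_fov_givens]). *)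

Section ConjugateTranspose.
Variable C : numClosedFieldType.

Lemma trmxC_mul (m n p : nat) (A : 'M[C]_(m, n)) (B : 'M[C]_(n, p)) :
  (A *m B) ^t* = B ^t* *m A ^t*.
Proof. by rewrite trmx_mul map_mxM. Qed.

Lemma hermsymmx_trmxC (n : nat) (H : 'M[C]_n) :
  (H \is hermsymmx) = (H == H ^t*).
Proof. by rewrite qualifE /= expr0 scale1r. Qed.

Lemma invmx_gram (n : nat) (V : 'M[C]_n) : V \in unitmx ->
  invmx (V *m V ^t*) = (invmx V) ^t* *m invmx V.
Proof.
move=> Vu; have Vu' : V ^t* \in unitmx by rewrite map_unitmx unitmx_tr.
have VVu : V *m V ^t* \in unitmx by rewrite unitmx_mul Vu.
rewrite trmx_inv map_invmx -[RHS](mulmxK VVu).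
by rewrite -!mulmxA (mulKmx Vu) (mulKmx Vu').
Qed.

(** The row [u^*] is nonzero, and its squared norm for [dotmx] is [u^* u]. *)
Lemma trmxC_mul_gt0 (n : nat) (u : 'cV[C]_n) : u != 0 -> 0 < (u ^t* *m u) 0 0.
Proof.
move=> u0; rewrite -[X in _ *m X]trmxCK -dotmxE dotmx_is_dotmx //.
by rewrite map_mx_eq0 trmx_eq0.
Qed.

End ConjugateTranspose.

(** [x^* W^* W x] is the squared norm of [W x], and [W x] vanishes only when
    [x] does. *)
Lemma posdef_gram (R : realType) (n : nat) (W : 'M[R[i]]_n) :
  W \in unitmx -> hermitian_posdef (W ^t* *m W).
Proof.
move=> Wu; split; first by rewrite hermsymmx_trmxC trmxC_mul trmxCK.
move=> x x0; rewrite mulmxA -trmxC_mul -mulmxA; apply: trmxC_mul_gt0.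
by apply: contra_neq x0 => Wx0; rewrite -(mulKmx Wu x) Wx0 mulmx0.
Qed.

(** Since [H] is Hermitian, [y = H x] has [y^* = x^* H], so the same [x]
    witnesses membership in both sets. *)
Lemma gen_two_sided_fov_givens (R : realType) (n : nat) (A V : 'M[R[i]]_n) :
  let H := invmx (V *m V ^t*) in
  H \is hermsymmx -> gen_two_sided_fov A V = givens_fov H A.
Proof.
move=> H; rewrite hermsymmx_trmxC => /eqP HH.
have ctHx (x : 'cV_n) : (H *m x) ^t* = x ^t* *m H by rewrite trmxC_mul -HH.
apply/seteqP; split=> z /=.
  by case=> x [_ [-> + ->]]; rewrite ctHx; exists x.
by case=> x x1 ->; exists x, (H *m x); rewrite ctHx.
Qed.

Theorem mainTheorem3 (R : realType) (n : nat)
    (A V : 'M[R[i]]_n) (lambda : 'rV[R[i]]_n) :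
  diagonalization A V lambda ->
  let H := invmx (V *m V ^t*) in
  hermitian_posdef H /\ gen_two_sided_fov A V = givens_fov H A.
Proof.
move=> [Vu _] H.
have Hpos : hermitian_posdef H.
  by rewrite /H invmx_gram //; apply: posdef_gram; rewrite unitmx_inv.
by split; [|apply: gen_two_sided_fov_givens; case: Hpos].
Qed.
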